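(* Let $\mathcal{M}$ be a Riemannian manifold, let $f \colon \mathcal{M} \to \mathbb{R}$ be of class $\mathrm{C}^2$, let $\bar x$ be a local minimum of $f$, let $f_{\mathcal{S}} = f(\bar x)$ and $\mathcal{S} = \{x \in \mathcal{M} : x \text{ is a local minimum of } f \text{ and } f(x) = f_{\mathcal{S}}\}$. Suppose $f$ satisfies the error bound with constant $\mu > 0$ around $\bar x$: $\mu\,\mathrm{dist}(x, \mathcal{S}) \leq \|\nabla f(x)\|$ for all $x$ in some neighborhood of $\bar x$. Then for all $\mu'$ with $0 < \mu' < \mu$, $f$ satisfies the Polyak–Łojasiewicz condition with constant $\mu'$ around $\bar x$: $f(x) - f_{\mathcal{S}} \leq \frac{1}{2\mu'}\|\nabla f(x)\|^2$ for all $x$ in some neighborhood of $\bar x$ (which may depend on $\mu'$).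
   Context: $\mathcal{M}$ is a smooth finite-dimensional Riemannian manifold with Riemannian distance $\mathrm{dist}$; $\nabla f$ is the Riemannian gradient; $\mathrm{dist}(x, \mathcal{S}) = \inf_{y \in \mathcal{S}} \mathrm{dist}(x, y)$. *)

(* Defs.v *)
From HB Require Import structures.
From mathcomp Require Import all_boot all_order all_algebra.
From mathcomp Require Import all_classical all_reals all_analysis.

Set Implicit Arguments.
Unset Strict Implicit.
Unset Printing Implicit Defensive.

Import Order.TTheory GRing.Theory Num.Theory.
Import numFieldNormedType.Exports.

Local Open Scope classical_set_scope.
Local Open Scope ring_scope.

(* [f] is of class C^k on the open set [U]. In finite dimension, f is C^(k+1)
   iff it is differentiable and x |-> Df(x) is C^k, the latter being equivalent
   to x |-> Df(x)[v] being C^k for every fixed v. *)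
Fixpoint Ck_on (R : realType) (V W : normedModType R) (k : nat)
    (U : set V) (f : V -> W) : Prop :=
  match k with
  | 0 => forall x, U x -> {for x, continuous f}
  | k'.+1 => (forall x, U x -> differentiable f x) /\
             forall v : V, Ck_on k' U (fun x => 'D_v f x)
  end.

Definition smooth_on (R : realType) (V W : normedModType R)
    (U : set V) (f : V -> W) : Prop :=
  forall k, Ck_on k U f.

(* A homeomorphism between an open subset of [M] and an open subset of R^n.
   The two maps are total, but only meaningful on [source] and [target]. *)
Record chart (R : realType) (n : nat) (M : topologicalType) := Chart {
  source : set M;
  target : set 'rV[R]_n;
  coord : M -> 'rV[R]_n;
  icoord : 'rV[R]_n -> M;
  open_source : open source;
  open_target : open target;
  coord_target : forall x, source x -> target (coord x);
  icoord_source : forall u, target u -> source (icoord u);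
  coordK : forall x, source x -> icoord (coord x) = x;
  icoordK : forall u, target u -> coord (icoord u) = u;
  coord_continuous : forall x, source x -> {for x, continuous coord};
  icoord_continuous : forall u, target u -> {for u, continuous icoord} }.

(* The atlas need not be maximal. [chart_at x] is a preferred chart around x;
   it only serves to represent tangent vectors at x (see below). *)
Record smoothManifold (R : realType) (n : nat) := SmoothManifold {
  carrier :> topologicalType;
  hausdorff_carrier : hausdorff_space carrier;
  second_countable_carrier : @second_countable carrier;
  atlas : set (chart R n carrier);
  chart_at : carrier -> chart R n carrier;
  chart_at_atlas : forall x, atlas (chart_at x);
  chart_at_source : forall x, source (chart_at x) x;
  smooth_transition : forall c d, atlas c -> atlas d ->
    smooth_on (target c `&` icoord c @^-1` source d) (coord d \o icoord c) }.

(* The tangent space T_x M is R^n: a tangent vector at x is represented by its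
   coordinates in the chart [chart_at x]. *)
Definition tangent (R : realType) (n : nat) (M : smoothManifold R n) (x : M) :
  Type := 'rV[R]_n.

(* The tangent vector at [icoord c u] whose coordinates in the chart [c] are
   [v], i.e. the image of [v] under the differential of [icoord c] at [u]. *)
Definition tangent_of_coord (R : realType) (n : nat) (M : smoothManifold R n)
    (c : chart R n M) (u v : 'rV[R]_n) : tangent (icoord c u) :=
  'D_v (coord (chart_at (icoord c u)) \o icoord c) u.

(* [gram x] is the Gram matrix of the inner product on T_x M. *)
Record riemannianManifold (R : realType) (n : nat) := RiemannianManifold {
  manifold :> smoothManifold R n;
  gram : manifold -> 'M[R]_n;
  inner (x : manifold) (v w : tangent x) : R :=
    ((v : 'rV[R]_n) *m gram x *m (w : 'rV[R]_n)^T) 0 0;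
  gram_sym : forall x, (gram x)^T = gram x;
  inner_posdef : forall (x : manifold) (v : 'rV[R]_n),
    v != 0 -> 0 < inner (v : tangent x) v;
  smooth_metric : forall c, atlas c -> forall v w : 'rV[R]_n,
    smooth_on (target c)
      (fun u => inner (tangent_of_coord c u v) (tangent_of_coord c u w) : R^o) }.

Definition tnorm (R : realType) (n : nat) (M : riemannianManifold R n) (x : M)
    (v : tangent x) : R :=
  Num.sqrt (inner v v).

Definition Ck_fun (R : realType) (n : nat) (M : smoothManifold R n) (k : nat)
    (f : M -> R) : Prop :=
  forall c, atlas c -> Ck_on k (target c) (f \o icoord c : 'rV[R]_n -> R^o).

(* The differential of [f] at [x] applied to the tangent vector [v]. *)
Definition differential (R : realType) (n : nat) (M : smoothManifold R n)
    (f : M -> R) (x : M) (v : tangent x) : R :=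
  'D_(v : 'rV[R]_n) (f \o icoord (chart_at x) : 'rV[R]_n -> R^o)
    (coord (chart_at x) x).

(* The unique vector g of T_x M with <g, v>_x = Df(x)[v] for all v. *)
Definition gradient (R : realType) (n : nat) (M : riemannianManifold R n)
    (f : M -> R) (x : M) : tangent x :=
  xget (0 : 'rV[R]_n)
    [set g | forall v : tangent x,
       inner (g : tangent x) v = differential f v].

Definition velocity (R : realType) (n : nat) (M : smoothManifold R n)
    (gamma : R -> M) (t : R) : tangent (gamma t) :=
  derive1 (coord (chart_at (gamma t)) \o gamma) t.

Definition C1_curve (R : realType) (n : nat) (M : smoothManifold R n)
    (U : set R) (gamma : R -> M) : Prop :=
  (forall t, U t -> {for t, continuous gamma}) /\
  forall c, atlas c ->
    Ck_on 1 (U `&` gamma @^-1` source c) (coord c \o gamma : R^o -> 'rV[R]_n).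

(* Being C^1 on the compact interval [a, b] means extending to a C^1 curve on
   an open neighborhood of it. *)
Definition C1_segment (R : realType) (n : nat) (M : smoothManifold R n)
    (a b : R) (gamma : R -> M) : Prop :=
  exists (U : set R) (sigma : R -> M),
    [/\ open U, `[a, b] `<=` U, C1_curve U sigma &
        forall t, t \in `[a, b] -> gamma t = sigma t].

Definition piecewise_C1 (R : realType) (n : nat) (M : smoothManifold R n)
    (a b : R) (gamma : R -> M) : Prop :=
  exists s : seq R, itv_partition a b s /\
    forall i, (i < size s)%N ->
      C1_segment (nth b (a :: s) i) (nth b s i) gamma.

(* At the finitely many break points of a piecewise C^1 curve [velocity] may
   be a junk value; this does not affect the integral. *)
Definition curve_length (R : realType) (n : nat) (M : riemannianManifold R n)
    (a b : R) (gamma : R -> M) : \bar R :=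
  (\int[lebesgue_measure]_(t in `[a, b]) (tnorm (velocity gamma t))%:E)%E.

(* M is not assumed connected: the distance between two distinct components
   is +oo. *)
Definition riemannian_dist (R : realType) (n : nat) (M : riemannianManifold R n)
    (x y : M) : \bar R :=
  ereal_inf [set curve_length 0 1 gamma | gamma in
    [set gamma : R -> M |
       [/\ piecewise_C1 0 1 gamma, gamma 0 = x & gamma 1 = y]]].

Definition dist_set (R : realType) (n : nat) (M : riemannianManifold R n)
    (x : M) (S : set M) : \bar R :=
  ereal_inf [set riemannian_dist x y | y in S].

Definition local_minimum (R : realType) (T : topologicalType) (f : T -> R)
    (x : T) : Prop :=
  \forall y \near x, f x <= f y.

Definition local_minima_at_level (R : realType) (T : topologicalType)
    (f : T -> R) (fS : R) : set T :=
  [set x | local_minimum f x /\ f x = fS].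

Definition error_bound (R : realType) (n : nat) (M : riemannianManifold R n)
    (f : M -> R) (xbar : M) (mu : R) : Prop :=
  \forall x \near xbar,
    (mu%:E * dist_set x (local_minima_at_level f (f xbar))
       <= (tnorm (gradient f x))%:E)%E.

Definition polyak_lojasiewicz (R : realType) (n : nat)
    (M : riemannianManifold R n) (f : M -> R) (xbar : M) (mu : R) : Prop :=
  \forall x \near xbar,
    f x - f xbar <= 1 / (2 * mu) * tnorm (gradient f x) ^+ 2.

(* Main.v *)
(** Fix a chart around [xbar], let [B] be the Gram matrix at [xbar], and write
    [F] for [f] in the chart. Given [x] near [xbar], either the gradient at [x] is
    bounded below and the inequality follows from continuity of [f], or the error
    bound provides [y] in [S] with [dist x y] at most slightly more than
    [|grad f x| / mu]. A short distance forces [y] into the chart, with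
    coordinates satisfying [|u - w|_B <= A ^ 2 * dist x y] where [A] is close
    to 1. Since [DF] vanishes at [w], the trapezoid rule gives
    [F u - F w <= DF(u)[u - w] / 2 + o(|u - w| ^ 2)], and by Cauchy-Schwarz
    [DF(u)[u - w] <= |grad f x| * A * |u - w|_B]; together these bound
    [f x - f xbar] by [(1 + o(1)) / (2 * mu) * |grad f x| ^ 2].

    The lower bound on the distance comes from testing the length of a curve
    against a globally defined C^1 function of the B-distance to [u], extended by
    a constant outside the chart, whose derivative along any C^1 curve is at most
    the speed. *)

Require Import Defs.
From mathcomp Require Import all_boot all_order all_algebra.
From mathcomp Require Import all_classical all_reals all_analysis.
From mathcomp Require Import measurable_realfun ring lra.

Import Order.TTheory GRing.Theory Num.Theory.
Import numFieldNormedType.Exports.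
(* MathComp has its own [coord] and [coord_continuous]. *)
Import Defs.

Set Implicit Arguments.
Unset Strict Implicit.
Unset Printing Implicit Defensive.

Local Open Scope classical_set_scope.
Local Open Scope ring_scope.

(** * Lengths of curves *)

(** The integral of a nonnegative function is the supremum of the integrals of the simple functions
    below it, so monotonicity asks for no measurability. *)
Lemma ge0_le_integral_nomeas d (T : measurableType d) (R : realType)
    (mu : {measure set T -> \bar R}) (f g : T -> \bar R) :
  (forall x, 0 <= f x)%E -> (forall x, f x <= g x)%E ->
  (\int[mu]_x f x <= \int[mu]_x g x)%E.
Proof.
move=> f0 fg; have g0 x : (0 <= g x)%E by exact: le_trans (f0 x) (fg x).
rewrite !ge0_integralTE//; apply: ge_ereal_sup => _ [h hf <-].
by apply: ereal_sup_ubound; exists h => // x; exact: le_trans (hf x) (fg x).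
Qed.

(* Working with a measurable minorant avoids proving that the speed of a
   piecewise C^1 curve is measurable; the minorant vanishes at the break points,
   where the speed may be a junk value. *)
Definition minorant (R : realType) (g : R -> R) (a b : R) (r : R) (h : R -> R) :=
  [/\ measurable_fun setT h, (forall t, 0 <= h t <= g t),
      (forall t, t \notin `]a, b[ -> h t = 0) &
      (r%:E <= \int[lebesgue_measure]_t (h t)%:E)%E].

(** The minorant is the positive part of [dF] on the open interval; the fundamental theorem of
    calculus bounds its integral from below. *)
Lemma minorant_derive (R : realType) (a b : R) (U : set R) (F dF g : R -> R) :
  a < b -> open U -> `[a, b] `<=` U ->
  (forall t, U t -> {for t, continuous dF}) ->
  (forall t, U t -> is_derive t 1 F (dF t)) ->
  (forall t, 0 <= g t) -> {in `]a, b[, forall t, dF t <= g t} ->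
  exists h, minorant g a b (F b - F a) h.
Proof.
move=> ab Uo abU cdF dFE g0 dFg.
pose h := (fun t => Num.max (dF t) 0) \_ `]a, b[ : R -> R.
have abU' : `]a, b[ `<=` U.
  by apply: subset_trans abU; exact: subset_itv_oo_cc.
have ch : {in `]a, b[%classic, continuous (fun t => Num.max (dF t) 0)}.
  move=> t /[!inE] tab; apply: continuous_max; last exact: cvg_cst.
  by apply: cdF; exact: abU'.
have mh : measurable_fun `]a, b[ (fun t => Num.max (dF t) 0).
  by apply: open_continuous_measurable_fun => //; exact: interval_open.
exists h; split.
- by apply/(measurable_restrictT _ _).1 => //; exact: measurable_itv.
- move=> t; rewrite /h patchE; case: ifPn => [|_]; last by rewrite lexx g0.
  by rewrite inE /= => tab; rewrite le_max lexx orbT /= ge_max dFg// g0.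
- by move=> t tab; rewrite /h patchE ifN// notin_setE /=; apply/negP.
have cF t : U t -> {for t, continuous F}.
  move=> Ut; apply: differentiable_continuous; apply/derivable1_diffP.
  by have [] := dFE t Ut.
have aU : U a by apply: abU; rewrite /= in_itv/= lexx ltW.
have bU : U b by apply: abU; rewrite /= in_itv/= lexx ltW.
have cdFab : {within `[a, b], continuous dF}.
  apply: continuous_in_subspaceT => t /[!inE] tab; apply: cdF; exact: abU.
rewrite EFinB -(@continuous_FTC2 _ dF F a b ab cdFab); first last.
- move=> t tab; rewrite derive1E; apply: (@derive_val _ _ _ _ _ _ _ (dFE t _)).
  exact: abU'.
- split.
  + by move=> t tab; have [] := dFE t (abU' _ tab).
  + by apply: cvg_at_right_filter; exact: cF.
  + by apply: cvg_at_left_filter; exact: cF.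
rewrite integral_itv_bndoo; last first.
  apply/measurable_EFinP; apply: open_continuous_measurable_fun.
    exact: interval_open.
  by move=> t /[!inE] tab; apply: cdF; exact: abU'.
(* Discarding the negative part of [dF] can only increase the integral, and what remains is [h]. *)
rewrite integral_mkcond integralE.
apply: (@le_trans _ _ (\int[lebesgue_measure]_x
   ((fun t => (dF t)%:E) \_ `]a, b[)^\+ x)%E).
  by rewrite geeDl // oppe_le0 integral_ge0.
apply: ge0_le_integral_nomeas => //= x.
rewrite funeposE /h !patchE; case: ifP => _.
  by rewrite -EFin_max.
by rewrite maxxx.
Qed.

(** At each point at most one of [h] and [k] is nonzero, both vanishing at [b], so the sum stays
    below [g]. *)
Lemma minorant_cat (R : realType) (g : R -> R) (a b c r s : R) h k :
  a <= b -> b <= c ->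
  minorant g a b r h -> minorant g b c s k -> minorant g a c (r + s) (h \+ k).
Proof.
move=> ab bc [mh hg h0 hr] [mk kg k0 ks]; split.
- exact: measurable_funD.
- move=> t; have [/andP[? ?] /andP[? ?]] := (hg t, kg t).
  rewrite addr_ge0//=; have [tb|bt] := leP t b.
    by rewrite k0 ?addr0// in_itv/= negb_and -!leNgt tb.
  by rewrite h0 ?add0r// in_itv/= negb_and -!leNgt (ltW bt) orbT.
- move=> t; rewrite in_itv/= negb_and -!leNgt => /orP tac.
  rewrite h0 ?k0 ?add0r// in_itv/= negb_and -!leNgt; apply/orP; case: tac => H.
  + by left; exact: le_trans H ab.
  + by right.
  + by left.
  + by right; exact: le_trans bc H.
rewrite /=; under eq_integral do rewrite EFinD.
rewrite ge0_integralD//.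
- by rewrite EFinD leeD.
- by move=> t _; rewrite lee_fin; have /andP[] := hg t.
- exact/measurable_EFinP.
- by move=> t _; rewrite lee_fin; have /andP[] := kg t.
- exact/measurable_EFinP.
Qed.

(** Induction on the partition: the increments of [psi] telescope and the minorants of the pieces
    are concatenated. *)
Lemma piecewise_C1_minorant (R : realType) (n : nat) (M : smoothManifold R n)
    (psi : M -> R) (g : R -> R) (gamma : R -> M) (a b : R) :
  (forall t, 0 <= g t) ->
  (forall c d, c < d -> C1_segment c d gamma ->
    exists h, minorant g c d (psi (gamma d) - psi (gamma c)) h) ->
  piecewise_C1 a b gamma ->
  exists h, minorant g a b (psi (gamma b) - psi (gamma a)) h.
Proof.
move=> g0 H [s []]; elim: s a => [|x s IH] a.
  move=> /itv_partition_nil -> _; exists (cst 0); split => //.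
  - by move=> t; rewrite lexx g0.
  - by rewrite subrr integral0.
move=> abs Hs.
have ax : a < x by move: abs => [] /= /andP[].
have xb : x <= b by exact: itv_partition_le (itv_partition_cons abs).
have [h hh] := H a x ax (Hs 0%N isT).
have [k kk] := IH x (itv_partition_cons abs) (fun i => Hs i.+1).
exists (h \+ k).
have -> : psi (gamma b) - psi (gamma a) =
  (psi (gamma x) - psi (gamma a)) + (psi (gamma b) - psi (gamma x)) by ring.
by apply: minorant_cat hh kk => //; exact: ltW.
Qed.

(** The endpoints are left out because the two curves agree only on one side of them. *)
Lemma velocity_eq_itv (R : realType) (n : nat) (M : smoothManifold R n)
  (a b : R) (gamma sigma : R -> M) t :
  (forall t, t \in `[a, b] -> gamma t = sigma t) -> t \in `]a, b[ ->
  velocity gamma t = velocity sigma t :> 'rV[R]_n.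
Proof.
move=> gs tab; rewrite /velocity !derive1E gs; last exact: subset_itv_oo_cc.
apply: near_eq_derive.
have : \forall s \near t, s \in `]a, b[ by exact: near_in_itvoo.
apply: filterS => s sab /=; rewrite gs//; exact: subset_itv_oo_cc.
Qed.

(** Along any competing path [psi] grows by at most the length. The hypothesis concerns curves on
    open sets because each smooth piece of a path comes with such an extension [sigma]. *)
Lemma le_riemannian_dist (R : realType) (n : nat) (M : riemannianManifold R n)
    (psi : M -> R) :
  (forall (U : set R) (sigma : R -> M), open U -> C1_curve U sigma ->
    exists dpsi : R -> R, forall t, U t ->
      [/\ {for t, continuous dpsi}, is_derive t 1 (psi \o sigma) (dpsi t) &
          dpsi t <= tnorm (velocity sigma t)]) ->
  forall x y, ((psi y - psi x)%:E <= riemannian_dist x y)%E.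
Proof.
move=> H x y; apply: le_ereal_inf_tmp => _ [gamma [gC <- <-] <-].
pose g t := tnorm (velocity gamma t).
have g0 t : 0 <= g t by exact: sqrtr_ge0.
have [c d cd [U [sigma [Uo cdU sC gs]]]|h [mh hg h0 hr]] :=
    @piecewise_C1_minorant _ _ M psi g gamma 0 1 g0 _ gC.
  have [dpsi dP] := H U sigma Uo sC.
  rewrite !gs ?in_itv/= ?lexx ?(ltW cd)//.
  apply: (@minorant_derive _ c d U (psi \o sigma) dpsi) => //.
  - by move=> t /dP[].
  - by move=> t /dP[].
  - move=> t tcd; have tcd' := subset_itv_oo_cc tcd.
    have [_ _] := dP t (cdU t tcd').
    by rewrite /g /tnorm /inner (velocity_eq_itv gs)// gs.
apply: le_trans hr _; rewrite /curve_length [leRHS]integral_mkcond.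
apply: ge0_le_integral_nomeas => t.
  by rewrite lee_fin; have /andP[] := hg t.
rewrite patchE; case: ifPn; first by rewrite lee_fin; have /andP[] := hg t.
rewrite notin_setE /= => t01; rewrite h0//; apply/negP => t01'.
by apply: t01; exact: subset_itv_oo_cc.
Qed.

(** * Quadratic forms *)

Lemma scalar_delta_expand (R : realType) n (L : 'rV[R]_n -> R) :
  scalar L -> forall v, L v = \sum_i v 0 i * L (delta_mx 0 i).
Proof.
move=> Ll v; have L0 : L 0 = 0.
  by have := Ll (-1) 0 0; rewrite scaler0 addr0 mulN1r addNr.
rewrite [in LHS](row_sum_delta v).
have LD x y : L (x + y) = L x + L y by rewrite -[x in LHS]scale1r Ll mul1r.
have LZ a x : L (a *: x) = a * L x by rewrite -[a *: x]addr0 Ll L0 addr0.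
elim/big_ind2 : _ => [|x x' y y' <- <-|i _] //.
Qed.

Lemma cvg_sum_fin (R : realType) (I : finType) (T : Type) (F : set_system T)
    {FF : Filter F} (f : I -> T -> R) (l : I -> R) :
  (forall i, f i x @[x --> F] --> l i) ->
  (\sum_i f i x) @[x --> F] --> \sum_i l i.
Proof.
move=> fl; elim: (index_enum I) => [|i s IH].
  rewrite big_nil; under eq_fun do rewrite big_nil; exact: cvg_cst.
rewrite big_cons; under eq_fun do rewrite big_cons.
exact: cvgD.
Qed.

Lemma le_coord_mx_norm (R : realType) n (v : 'rV[R]_n) i : `|v 0 i| <= `|v|.
Proof.
rewrite [leRHS]/Num.Def.normr /= mx_normrE.
exact: (le_bigmax _ (fun ij : 'I_1 * 'I_n => `|v ij.1 ij.2|) (0, i)).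
Qed.

(** Pointwise continuity becomes uniform in [v] because a bilinear form has finitely many
    coefficients. It serves both for the metric and for the Hessian of [f] in a chart. *)
Lemma near_quadratic (R : realType) (T : topologicalType) n (u0 : T)
    (Q : T -> 'rV[R]_n -> 'rV[R]_n -> R) :
  (\forall u \near u0,
    (forall w, scalar (Q u ^~ w)) /\ (forall v, scalar (Q u v))) ->
  (forall v w, {for u0, continuous (fun u => Q u v w)}) ->
  forall e, 0 < e ->
  \forall u \near u0, forall v, `|Q u v v - Q u0 v v| <= e * `|v| ^+ 2.
Proof.
move=> Ql Qc e e0.
have Qe u : (forall w, scalar (Q u ^~ w)) /\ (forall v, scalar (Q u v)) ->
    forall v, Q u v v = \sum_i \sum_j
      v 0 i * v 0 j * Q u (delta_mx 0 i) (delta_mx 0 j).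
  move=> [Ql1 Ql2] v; rewrite (scalar_delta_expand (Ql1 v)).
  apply: eq_bigr => i _; rewrite (scalar_delta_expand (Ql2 _)) mulr_sumr.
  by apply: eq_bigr => j _; rewrite mulrA.
pose d : R := e / (n * n).+1%:R.
have d0 : 0 < d by rewrite divr_gt0.
(* The tolerance [d] is shared among [n * n] terms; the successor in its denominator covers
   [n = 0]. *)
have Qd : \forall u \near u0, forall ij : 'I_n * 'I_n,
    `|Q u0 (delta_mx 0 ij.1) (delta_mx 0 ij.2) -
      Q u (delta_mx 0 ij.1) (delta_mx 0 ij.2)| <= d.
  apply: filter_forall => ij.
  by have /cvgrPdist_le := Qc (delta_mx 0 ij.1) (delta_mx 0 ij.2); apply.
near=> u => v.
rewrite (Qe u); last by near: u.
rewrite (Qe u0); last by exact: nbhs_singleton Ql.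
rewrite -sumrB; apply: le_trans (ler_norm_sum _ _ _) _.
apply: (@le_trans _ _ (\sum_(i < n) \sum_(j < n) d * `|v| ^+ 2)).
  apply: ler_sum => i _; rewrite -sumrB; apply: le_trans (ler_norm_sum _ _ _) _.
  apply: ler_sum => j _; rewrite -mulrBr !normrM mulrC expr2 ler_pM //.
    rewrite distrC.
    by move: (near Qd u) => /(_ _ (i, j)); apply.
  by rewrite ler_pM// le_coord_mx_norm.
rewrite !sumr_const !card_ord -mulrnA -mulr_natl mulrA.
apply: ler_wpM2r; first by rewrite exprn_ge0.
by rewrite /d mulrCA -[leRHS]mulr1 ler_pM2l// ler_pdivrMr// mul1r ler_nat.
Unshelve. all: by end_near. Qed.

(** By conversion, [inner] at [x] is [bform (gram x)]. *)
Definition bform (R : realType) n (B : 'M[R]_n) (v w : 'rV[R]_n) : R :=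
  (v *m B *m w^T) 0 0.

Definition posdef (R : realType) n (B : 'M[R]_n) :=
  B^T = B /\ forall v, v != 0 -> 0 < bform B v v.

Section bform.
Variables (R : realType) (n : nat) (B : 'M[R]_n).
Implicit Types v w : 'rV[R]_n.

Lemma bformlP w : scalar (bform B ^~ w).
Proof. by move=> a u v; rewrite /bform !mulmxDl -!scalemxAl !mxE. Qed.

Lemma bformrP v : scalar (bform B v).
Proof.
by move=> a u w; rewrite /bform linearP/= mulmxDr -scalemxAr !mxE.
Qed.

Lemma bformE v w : bform B v w = \sum_i \sum_j B i j * (v 0 i * w 0 j).
Proof.
rewrite (scalar_delta_expand (bformlP w)); apply: eq_bigr => i _.
rewrite (scalar_delta_expand (bformrP _)) mulr_sumr; apply: eq_bigr => j _.
rewrite /bform -rowE trmx_delta -colE !mxE; ring.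
Qed.

Lemma bformZZ a v : bform B (a *: v) (a *: v) = a ^+ 2 * bform B v v.
Proof. by rewrite /bform linearZ /= -scalemxAr -!scalemxAl !mxE mulrA. Qed.

Hypothesis Bpos : posdef B.

Lemma bformC v w : bform B v w = bform B w v.
Proof.
rewrite /bform -{1}(Bpos.1) -[in LHS](trmxK (v *m _)) -trmx_mul mxE.
by rewrite trmx_mul trmxK mulmxA.
Qed.

Lemma bform_ge0 v : 0 <= bform B v v.
Proof.
have [->|v0] := eqVneq v 0; first by rewrite /bform !mul0mx mxE.
exact/ltW/(Bpos.2).
Qed.

Lemma bform_CS v w : bform B v w <= Num.sqrt (bform B v v) * Num.sqrt (bform B w w).
Proof.
rewrite -sqrtrM ?bform_ge0//; apply: le_trans (ler_norm _) _.
rewrite -sqrtr_sqr ler_wsqrtr//.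
have [->|w0] := eqVneq w 0.
  by rewrite /bform trmx0 !mulmx0 mxE expr0n /= mulr0.
have bw := Bpos.2 _ w0.
(* The form at this vector equals [bform B w w] times the Gram determinant of [v] and [w]. *)
have := bform_ge0 (bform B w w *: v + (- bform B v w) *: w).
rewrite bformlP bformrP.
rewrite -[(- _) *: w]addr0 !bformlP !bformrP.
have z u : bform B 0 u = 0 by rewrite /bform !mul0mx mxE.
have z' u : bform B u 0 = 0 by rewrite /bform trmx0 mulmx0 mxE.
rewrite !z !z' (bformC w v).
move: bw; set a := bform B v v; set b := bform B v w; set c := bform B w w.
move=> c0; rewrite (_ : _ + _ = c * (a * c - b ^+ 2)); last by ring.
by rewrite pmulr_rge0// subr_ge0.
Qed.

Lemma continuous_bform v : {for v, continuous (fun v => bform B v v)}.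
Proof.
rewrite (_ : (fun v => _) = fun v => \sum_i \sum_j B i j * (v 0 i * v 0 j)).
  apply: (@cvg_sum_fin _ _ _ (nbhs v)) => i.
  apply: (@cvg_sum_fin _ _ _ (nbhs v)) => j.
  apply: cvgM; first exact: cvg_cst.
  by apply: cvgM; exact: matrix_normedtype.coord_continuous.
by apply/funext => w; rewrite bformE.
Qed.

(** The form attains a positive minimum on the compact unit sphere, and homogeneity does the rest.
    The sphere is empty when the space is zero, hence the separate case. *)
Lemma bform_lower_bound :
  exists2 l, 0 < l & forall v, l * `|v| ^+ 2 <= bform B v v.
Proof.
pose A := [set v : 'rV[R]_n | `|v| = 1].
have [[v vN0]|H] := pselect (exists v : 'rV[R]_n, v != 0); last first.
  exists 1 => // v; have -> : v = 0.
    by apply/eqP; apply/negPn/negP => vN0; apply: H; exists v.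
  by rewrite normr0 expr0n mulr0 bform_ge0.
have A0 : A !=set0.
  exists (`|v|^-1 *: v).
  by rewrite /A /= normrZ normfV normr_id mulVf// normr_eq0.
have cA : compact A.
  apply: bounded_closed_compact.
    exists 1; split => // x x1 w; rewrite /A /= => ->; exact: ltW.
  apply: (@preimage_closed _ _ (fun v : 'rV[R]_n => `|v|) [set 1]).
    by move=> x _; exact: norm_continuous.
  exact: closed_eq.
have [c cA1 cP] := @EVT_min_rV _ _ (fun v => bform B v v) A A0 cA
  (continuous_subspaceT continuous_bform).
move: cA1; rewrite inE /A/= => c1.
exists (bform B c c).
  by apply: Bpos.2; rewrite -normr_eq0 c1 oner_neq0.
move=> w; have [->|w0] := eqVneq w 0.
  by rewrite normr0 expr0n mulr0 bform_ge0.
have nw : 0 < `|w| by rewrite normr_gt0.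
have := cP (`|w|^-1 *: w); rewrite inE bformZZ exprVn => /(_ _).
rewrite mulrC -ler_pdivlMr ?exprn_gt0// mulrC; apply.
by rewrite /A /= normrZ normfV normr_id mulVf// normr_eq0.
Qed.

Lemma posdef_unit : B \in unitmx.
Proof.
rewrite -row_free_unit; apply: inj_row_free => v vB; apply/eqP.
apply/negPn/negP => /Bpos.2; rewrite /bform vB mul0mx mxE ltxx //.
Qed.

Lemma bform_riesz (L : 'rV[R]_n -> R) : scalar L ->
  exists g, forall v, bform B g v = L v.
Proof.
move=> Ll; exists ((\row_i L (delta_mx 0 i)) *m invmx B) => v.
rewrite /bform mulmxKV ?posdef_unit// mxE (scalar_delta_expand Ll).
by apply: eq_bigr => i _; rewrite !mxE mulrC.
Qed.

End bform.

(** * Differentiation in charts *)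

Lemma derive_scalar (R : realType) (V : normedModType R) (f : V -> R^o) (x : V) :
  differentiable f x -> scalar (fun v => 'D_v f x).
Proof. by move=> df a v w; rewrite !deriveE// linearP. Qed.

Lemma derive_linear (R : realType) (V W : normedModType R) (f : V -> W) (x : V) :
  differentiable f x -> linear (fun v => 'D_v f x).
Proof. by move=> df a v w; rewrite !deriveE// linearP. Qed.

(** The factorization is only local since [icoord] inverts [coord] only on the chart. *)
Lemma derive_chain (R : realType) (U V W : normedModType R) (f : V -> W)
    (g : U -> V) (h : U -> W) (x v : U) :
  differentiable g x -> differentiable f (g x) ->
  (\forall y \near x, h y = f (g y)) ->
  'D_v h x = 'D_('D_v g x) f (g x).
Proof.
move=> dg df hE; rewrite (near_eq_derive _ hE) (deriveE _ df) (deriveE _ dg).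
have dfg : differentiable (f \o g) x by exact: differentiable_comp.
by rewrite -[RHS](congr1 (fun h => h v) (diff_comp dg df)) -(deriveE _ dfg).
Qed.

Section smooth_manifold.
Variables (R : realType) (n : nat) (M : smoothManifold R n).
Implicit Types (c d : chart R n M) (x : M) (u v w : 'rV[R]_n).

Lemma transition_differentiable c d u : atlas c -> atlas d ->
  target c u -> source d (icoord c u) -> differentiable (coord d \o icoord c) u.
Proof. by move=> ac ad uc du; apply: (smooth_transition ac ad 1).1; split. Qed.

Lemma near_target c u : target c u -> \forall v \near u, target c v.
Proof. by move=> uc; apply: open_nbhs_nbhs; split => //; exact: open_target. Qed.

Lemma near_source c x : source c x -> \forall y \near x, source c y.
Proof. by move=> xc; apply: open_nbhs_nbhs; split => //; exact: open_source. Qed.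

Lemma icoord_near_source c d u : target c u -> source d (icoord c u) ->
  \forall v \near u, source d (icoord c v).
Proof. by move=> uc ud; apply: (icoord_continuous uc); exact: near_source. Qed.

(** Replaces the preferred chart, which moves with [t], by one fixed chart followed by a transition
    map. *)
Lemma velocityE c (U : set R) (sigma : R -> M) (t : R) :
  open U -> C1_curve U sigma -> atlas c -> U t -> source c (sigma t) ->
  velocity sigma t =
  'D_(derive1 (coord c \o sigma) t) (coord (chart_at (sigma t)) \o icoord c)
     (coord c (sigma t)) :> 'rV[R]_n.
Proof.
move=> Uo [sc sC1] ac Ut tc; rewrite /velocity !derive1E.
have st := coordK tc.
apply: derive_chain.
- exact: (sC1 c ac).1 t (conj Ut tc).
- apply: transition_differentiable => //; first exact: chart_at_atlas.
    exact: coord_target.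
  by rewrite st; exact: chart_at_source.
- have : \forall s \near t, source c (sigma s).
    by apply: sc Ut _ _; exact: near_source.
  by apply: filterS => s sc' /=; rewrite coordK.
Qed.

Lemma differential_coord (f : M -> R) c x v :
  Ck_fun 1 f -> atlas c -> source c x ->
  'D_v (f \o icoord c : 'rV[R]_n -> R^o) (coord c x) =
  differential f ('D_v (coord (chart_at x) \o icoord c) (coord c x) : tangent x).
Proof.
move=> fC ac xc; rewrite /differential.
have xcK := coordK xc; have tc := coord_target xc.
have sx : source (chart_at x) (icoord c (coord c x)).
  by rewrite xcK; exact: chart_at_source.
have E : coord (chart_at x) x = (coord (chart_at x) \o icoord c) (coord c x).
  by rewrite /= xcK.
rewrite E; apply: derive_chain.
- apply: transition_differentiable => //; exact: chart_at_atlas.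
- rewrite -E; apply: (fC _ (chart_at_atlas x)).1.
  exact/coord_target/chart_at_source.
- by apply: filterS (icoord_near_source tc sx) => y ys /=; rewrite coordK.
Qed.

Lemma differential_scalar (f : M -> R) x :
  Ck_fun 1 f -> scalar (fun v : 'rV[R]_n => differential f (v : tangent x)).
Proof.
move=> fC; apply: derive_scalar; apply: (fC _ (chart_at_atlas x)).1.
exact/coord_target/chart_at_source.
Qed.

End smooth_manifold.

(** * The metric and the gradient in a chart *)

(** For [c] in the atlas this depends smoothly on [u], whereas [gram] refers to a preferred chart
    that may jump from point to point. *)
Definition chart_metric (R : realType) n (M : riemannianManifold R n)
    (c : chart R n M) (u v w : 'rV[R]_n) : R :=
  inner (tangent_of_coord c u v) (tangent_of_coord c u w).

Section riemannian_manifold.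
Variables (R : realType) (n : nat) (M : riemannianManifold R n).
Implicit Types (c d : chart R n M) (x : M) (u v w : 'rV[R]_n).

Lemma posdef_gram x : posdef (gram x).
Proof. by split; [exact: gram_sym|move=> v v0; exact: (@inner_posdef _ _ M x)]. Qed.

Lemma chart_metricE c x v w : source c x ->
  chart_metric c (coord c x) v w =
  bform (gram x) ('D_v (coord (chart_at x) \o icoord c) (coord c x))
    ('D_w (coord (chart_at x) \o icoord c) (coord c x)).
Proof.
by move=> xc; rewrite /chart_metric /inner /tangent_of_coord coordK.
Qed.

(** The transition map from the preferred chart to itself is the identity near the point, and so is
    its differential. *)
Lemma chart_metric_at x v w :
  chart_metric (chart_at x) (coord (chart_at x) x) v w = bform (gram x) v w.
Proof.
have xs := chart_at_source x.
have H z : 'D_z (coord (chart_at x) \o icoord (chart_at x))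
   (coord (chart_at x) x) = z.
  rewrite -[RHS](derive_id (coord (chart_at x) x)); apply: near_eq_derive.
  apply: filterS (near_target (coord_target xs)) => u uT.
  by rewrite /= icoordK.
by rewrite chart_metricE// !H.
Qed.

Lemma chart_metric_scalar c u : atlas c -> target c u ->
  (forall w, scalar (chart_metric c u ^~ w)) /\
  (forall v, scalar (chart_metric c u v)).
Proof.
move=> ac uc; have us := icoord_source uc.
rewrite -(icoordK uc).
have dT : linear (fun v => 'D_v (coord (chart_at (icoord c u)) \o icoord c)
    (coord c (icoord c u)) : 'rV[R]_n).
  rewrite icoordK//.
  apply: derive_linear; apply: transition_differentiable => //.
  exact: chart_at_atlas. exact: chart_at_source.
by split=> z a v w; rewrite !chart_metricE// dT ?bformlP ?bformrP.
Qed.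

Lemma chart_metric_continuous c u v w : atlas c -> target c u ->
  {for u, continuous (fun u => chart_metric c u v w)}.
Proof. by move=> ac uc; exact: (@smooth_metric _ _ M c ac v w 0%N). Qed.

Lemma tnorm_velocity c (U : set R) (sigma : R -> M) (t : R) :
  open U -> C1_curve U sigma -> atlas c -> U t -> source c (sigma t) ->
  let v := derive1 (coord c \o sigma) t in
  tnorm (velocity sigma t) =
  Num.sqrt (chart_metric c (coord c (sigma t)) v v).
Proof.
move=> Uo sC ac Ut tc v; rewrite /tnorm /inner (velocityE Uo sC ac Ut tc).
by rewrite chart_metricE.
Qed.

(** Riesz representation makes the set in [gradient] nonempty, so [xget] does not fall back on its
    default. *)
Lemma gradientP (f : M -> R) x (v : tangent x) : Ck_fun 1 f ->
  inner (gradient f x) v = differential f v.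
Proof.
move=> fC; rewrite /gradient; case: xgetP => [g _ gP|]; first exact: gP.
have [g gP] := bform_riesz (posdef_gram x) (differential_scalar x fC).
by move=> /(_ g); case.
Qed.

Lemma derive_le_gradient (f : M -> R) c x v :
  Ck_fun 1 f -> atlas c -> source c x ->
  'D_v (f \o icoord c : 'rV[R]_n -> R^o) (coord c x) <=
  tnorm (gradient f x) * Num.sqrt (chart_metric c (coord c x) v v).
Proof.
move=> fC ac xc; rewrite differential_coord// -gradientP// chart_metricE//.
exact: bform_CS (posdef_gram x) _ _.
Qed.

End riemannian_manifold.

(** * Lower bounds on the Riemannian distance *)

(** Squaring removes the corner at 0, where the difference quotient is either [h] or 0. *)
Lemma is_derive_max0_sqr (R : realType) (x : R) :
  is_derive x 1 (fun y : R => Num.max 0 y ^+ 2) (2 * Num.max 0 x).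
Proof.
have [x0|x0|->] := ltgtP x 0.
- rewrite mulr0; apply: (@near_eq_is_derive _ _ _ (cst 0)) => //; last first.
  near=> y; rewrite /= max_l ?expr0n//; near: y.
  by apply: filterS (lt_nbhsl x0) => y; exact: ltW.
- have : is_derive x 1 ((@id R) ^+ 2) (2 * x).
    by apply: is_derive_eq; rewrite /GRing.scale /= mulr1 expr1.
  apply: near_eq_is_derive; near=> y.
  rewrite max_r//; near: y.
  by apply: filterS (lt_nbhsr x0) => y; exact: ltW.
- rewrite mulr0.
  suff H : (fun h : R => h^-1 *: (Num.max 0 (h *: (1 : R) + 0) ^+ 2 -
      Num.max 0 (0 : R) ^+ 2)) @ 0^' --> (0 : R).
    split; first by apply/cvg_ex; exists 0.
    exact: cvg_lim.
  apply/cvgrPdist_le => e e0; near=> h.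
  rewrite maxxx expr0n /= subr0 addr0 sub0r normrN /GRing.scale /= mulr1.
  have [h0|h0] := leP 0 h.
    rewrite expr2 mulrA mulVf ?mul1r; last by near: h; exact: nbhs_dnbhs_neq.
    by near: h; exact: dnbhs0_le.
  by rewrite expr0n mulr0 normr0 ltW.
Unshelve. all: by end_near. Qed.

Section profile.
Variables (R : realType) (m k : R).
Hypothesis k0 : 0 < k.

(* A C^1 nondecreasing function of the squared radius [s], constant for
   [s >= m^2], with slope at most [m] as a function of the radius. *)
Definition profile (s : R) : R :=
  - (Num.max 0 (m - Num.sqrt (s + k ^+ 2)) ^+ 2) / 2.

Definition dprofile (s : R) : R :=
  Num.max 0 (m - Num.sqrt (s + k ^+ 2)) / (2 * Num.sqrt (s + k ^+ 2)).

(** The shift by [k ^+ 2] keeps the square root differentiable at [s = 0]. *)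
Lemma is_derive_profile (s : R) : 0 <= s -> is_derive s 1 profile (dprofile s).
Proof.
move=> s0; have sk : 0 < s + k ^+ 2 by rewrite ltr_wpDl// exprn_gt0.
have H1 : is_derive s 1 (fun s => s + k ^+ 2 : R) 1.
  by apply: is_derive_eq; rewrite addr0.
have H2 := @is_derive1_comp _ (@Num.sqrt R) (fun s => s + k ^+ 2) s _ _
  (is_derive1_sqrt sk) H1.
have H3 : is_derive s 1 (fun s => m - Num.sqrt (s + k ^+ 2))
    (- (2 * Num.sqrt (s + k ^+ 2))^-1).
  have H := is_deriveB (is_derive_cst m s 1) H2.
  by apply: is_derive_eq; rewrite sub0r mulr1.
have H4 := @is_derive1_comp _ (fun y : R => Num.max 0 y ^+ 2)
  (fun s => m - Num.sqrt (s + k ^+ 2)) s _ _ (is_derive_max0_sqr _) H3.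
have -> : profile = (- 2^-1 : R) \*: ((fun y : R => Num.max 0 y ^+ 2) \o
    (fun s => m - Num.sqrt (s + k ^+ 2))).
  by apply/funext => t; rewrite /profile /= /GRing.scale /= mulNr mulrC mulNr.
apply: is_derive_eq; rewrite /dprofile /GRing.scale /=.
have q0 : Num.sqrt (s + k ^+ 2) != 0 by rewrite gt_eqF// sqrtr_gt0.
by field.
Qed.

Lemma continuous_dprofile (s : R) : 0 <= s -> {for s, continuous dprofile}.
Proof.
move=> s0; have sk : 0 < s + k ^+ 2 by rewrite ltr_wpDl// exprn_gt0.
have cs : {for s, continuous (fun s => Num.sqrt (s + k ^+ 2))}.
  apply: continuous_comp; last exact: sqrt_continuous.
  by apply: cvgD; [exact: cvg_id|exact: cvg_cst].
apply: cvgM.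
  apply: (@continuous_max R R (cst 0) (fun s => m - Num.sqrt (s + k ^+ 2)) s).
    exact: cvg_cst.
  by apply: cvgB; [exact: cvg_cst|exact: cs].
apply: cvgV; first by rewrite mulf_neq0// gt_eqF// sqrtr_gt0.
by apply: cvgM; [exact: cvg_cst|exact: cs].
Qed.

Lemma dprofile_ge0 s : 0 <= dprofile s.
Proof. by rewrite /dprofile divr_ge0 ?le_max ?lexx// mulr_ge0// sqrtr_ge0. Qed.

(** The left-hand side is the slope with respect to the radius [Num.sqrt s]. *)
Lemma dprofile_le s : 0 <= m -> 0 <= s -> 2 * dprofile s * Num.sqrt s <= m.
Proof.
move=> m0 s0; have sk : 0 < s + k ^+ 2 by rewrite ltr_wpDl// exprn_gt0.
have q0 : 0 < Num.sqrt (s + k ^+ 2) by rewrite sqrtr_gt0.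
have -> : 2 * dprofile s * Num.sqrt s = Num.max 0 (m - Num.sqrt (s + k ^+ 2)) *
    (Num.sqrt s / Num.sqrt (s + k ^+ 2)).
  by rewrite /dprofile; field; rewrite gt_eqF.
rewrite -[leRHS]mulr1; apply: ler_pM.
- by rewrite le_max lexx.
- by rewrite divr_ge0 ?sqrtr_ge0.
- by rewrite ge_max m0 gerBl sqrtr_ge0.
- by rewrite ler_pdivrMr// mul1r ler_wsqrtr// lerDl sqr_ge0.
Qed.

Lemma profile_eq0 s : m ^+ 2 <= s -> profile s = 0 /\ dprofile s = 0.
Proof.
move=> ms; have H : Num.max 0 (m - Num.sqrt (s + k ^+ 2)) = 0.
  apply/max_l; rewrite subr_le0; have [m0|m0] := leP m 0.
    exact: le_trans m0 (sqrtr_ge0 _).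
  rewrite -[leLHS]gtr0_norm// -sqrtr_sqr ler_wsqrtr//.
  by rewrite (le_trans ms)// lerDl sqr_ge0.
by rewrite /profile /dprofile H expr0n /= oppr0 !mul0r.
Qed.

End profile.

Lemma cvg_bform (R : realType) n (B : 'M[R]_n) (T : Type) (F : set_system T)
    {FF : Filter F} (v w : T -> 'rV[R]_n) (v0 w0 : 'rV[R]_n) :
  v @ F --> v0 -> w @ F --> w0 ->
  bform B (v x) (w x) @[x --> F] --> bform B v0 w0.
Proof.
move=> vv ww; rewrite bformE; under eq_fun do rewrite bformE.
apply: cvg_sum_fin => i; apply: cvg_sum_fin => j.
apply: cvgM; first exact: cvg_cst.
have cc (f : T -> 'rV[R]_n) (f0 : 'rV[R]_n) l : f @ F --> f0 ->
    f x 0 l @[x --> F] --> f0 0 l.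
  move=> ff; apply: (@cvg_comp _ _ _ f (fun z : 'rV[R]_n => z 0 l) _ _ _ ff).
  exact: matrix_normedtype.coord_continuous.
by apply: cvgM; exact: cc.
Qed.

Lemma is_derive_bform (R : realType) n (B : 'M[R]_n) (u : R -> 'rV[R]_n)
    (a : 'rV[R]_n) (t : R) : posdef B -> derivable u t 1 ->
  is_derive t 1 (fun s => bform B (u s - a) (u s - a))
    (2 * bform B (u t - a) (derive1 u t)).
Proof.
move=> Bpos du.
have dui i : is_derive t 1 (fun s => (u s - a) 0 i) ((derive1 u t) 0 i).
  have -> : (fun s => (u s - a) 0 i) = (fun s => u s 0 i) \- cst (a 0 i).
    by apply/funext => s; rewrite !mxE.
  have H : is_derive t 1 (fun s => u s 0 i) ((derive1 u t) 0 i).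
    rewrite derive1E derive_mx// mxE; apply: derivableP.
    by move/derivable_mxP : du; exact.
  by apply: is_derive_eq; rewrite subr0.
have -> : (fun s => bform B (u s - a) (u s - a)) =
    \sum_i \sum_j (B i j \*: ((fun s => (u s - a) 0 i) * (fun s => (u s - a) 0 j))).
  apply/funext => s; rewrite bformE fct_sumE; apply: eq_bigr => i _.
  by rewrite fct_sumE.
apply: is_derive_eq.
rewrite mulr_natl mulr2n {1}bformC// !bformE -big_split /=.
apply: eq_bigr => i _; rewrite -big_split /=; apply: eq_bigr => j _.
by rewrite /GRing.scale /=; ring.
Qed.

(** Arithmetic of the speed estimate: [b] pairs displacement and velocity, [s] is the radius, [v]
    and [w] are the speeds for [B] and for the metric. *)
Lemma mul_chain_le (R : realType) (m A d b s v w : R) :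
  0 <= d -> b <= s * v -> 2 * d * s <= m -> v <= A * w -> 0 <= s -> 0 <= v ->
  d * (2 * b) <= m * A * w.
Proof.
move=> d0 bsv dsm vAw s0 v0.
apply: (@le_trans _ _ (2 * d * s * v)).
  have -> : 2 * d * s * v = d * (2 * (s * v)) by ring.
  by rewrite !ler_wpM2l.
by rewrite -[leRHS]mulrA; apply: ler_pM => //; rewrite !mulr_ge0.
Qed.

(** * A cutoff function growing at most at unit speed *)

Section cutoff.
Variables (R : realType) (n : nat) (M : riemannianManifold R n).
Variables (c : chart R n M) (B : 'M[R]_n) (a u0 : 'rV[R]_n) (r m k A : R).
Hypotheses (ac : atlas c) (Bpos : posdef B).
Hypotheses (r0 : 0 < r) (m0 : 0 < m) (k0 : 0 < k) (A0 : 0 < A).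
Hypothesis ball_target : forall u, `|u0 - u| <= r -> target c u.
Hypothesis ball_metric : forall u, `|u0 - u| <= r -> forall v,
  bform B v v <= A ^+ 2 * chart_metric c u v v.
Hypothesis ball_bform : forall u, bform B (u - a) (u - a) < m ^+ 2 ->
  `|u0 - u| < r.

Let core : set M := icoord c @` closed_ball u0 r.

(** The core is a compact set in a Hausdorff space. As [cutoff] vanishes off it, closedness yields
    regularity of [cutoff] at the points outside the chart. *)
Lemma closed_core : closed core.
Proof.
apply: compact_closed; first exact: hausdorff_carrier.
apply: continuous_compact.
  apply: continuous_in_subspaceT => u; rewrite inE closed_ballE// => ur.
  exact/icoord_continuous/ball_target.
apply: bounded_closed_compact; last exact: closed_ball_closed.
rewrite closed_ballE//; exists (r + `|u0|); split; first exact: num_real.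
move=> x rx u /= ur.
apply: le_trans (ltW rx); rewrite -[u](subKr u0).
by rewrite (le_trans (ler_normB _ _))// addrC lerD2r.
Qed.

Lemma mem_core z : source c z -> `|u0 - coord c z| <= r -> core z.
Proof.
by move=> cz zr; exists (coord c z); [rewrite closed_ballE|rewrite coordK].
Qed.

(** Of the normalizing factor, [m] bounds the slope of the profile and [A] compares the norm of [B]
    with that of the metric. *)
Definition cutoff (z : M) : R :=
  if `[< source c z /\ `|u0 - coord c z| <= r >] then
    (m * A)^-1 * profile m k (bform B (coord c z - a) (coord c z - a))
  else 0.

(** By [ball_bform], points of the chart beyond the ball lie where the profile is already 0, so the
    two branches fit together. *)
Lemma cutoff_source z : source c z ->
  cutoff z = (m * A)^-1 * profile m k (bform B (coord c z - a) (coord c z - a)).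
Proof.
move=> cz; rewrite /cutoff; case: asboolP => // H.
rewrite (@profile_eq0 _ _ _ _ _).1 ?mulr0// leNgt; apply/negP => /ball_bform zr.
by apply: H; split => //; exact: ltW.
Qed.

Lemma cutoff_le_dist x y : ((cutoff y - cutoff x)%:E <= riemannian_dist x y)%E.
Proof.
apply: le_riemannian_dist => U sigma Uo sC.
pose u := coord c \o sigma.
pose q t := bform B (u t - a) (u t - a).
pose dpsi t := (m * A)^-1 * (dprofile m k (q t) *
  (2 * bform B (u t - a) (derive1 u t))).
pose f t := if `[< source c (sigma t) /\ `|u0 - u t| <= r >]
  then dpsi t else 0.
exists f => t Ut.
have qge0 s : 0 <= q s by exact: bform_ge0.
have dpsiE s : source c (sigma s) ->
  f s = dpsi s.
  move=> cs; rewrite /f; case: asboolP => // H.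
  rewrite /dpsi (@profile_eq0 _ _ _ _ _).2 ?mul0r ?mulr0// leNgt.
  apply/negP => /ball_bform zr.
  by apply: H; split => //; exact: ltW.
(* Inside the chart the derivative is given by the chain rule; outside, the curve avoids the closed
   core near [t] and everything vanishes there. *)
have [tc|tc] := pselect (source c (sigma t)).
  have nc : \forall s \near t, source c (sigma s).
    by apply: sC.1 Ut _ _; exact: near_source.
  have [du cu'] := sC.2 c ac.
  have dut : derivable u t 1 by apply/derivable1_diffP; exact: du.
  have cut : {for t, continuous u}.
    by apply: differentiable_continuous; exact: du.
  have cdut : {for t, continuous (derive1 u)}.
    rewrite (_ : derive1 u = fun x => 'D_1 u x); last first.
      by apply/funext => s; rewrite derive1E.
    exact: cu'.
  have cua : {for t, continuous (fun s => u s - a)}.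
    by apply: cvgB => //; exact: cvg_cst.
  have dq := is_derive_bform a Bpos dut.
  have cdpsi : {for t, continuous dpsi}.
    apply: cvgM; first exact: cvg_cst.
    apply: cvgM.
      apply: (@continuous_comp _ _ _ q (dprofile m k)).
        exact: cvg_bform.
      exact: continuous_dprofile.
    apply: cvgM; first exact: cvg_cst.
    exact: cvg_bform.
  split.
  - rewrite /prop_for /continuous_at dpsiE//.
    apply: cvg_trans cdpsi; apply: near_eq_cvg.
    by apply: filterS nc => s cs; rewrite dpsiE.
  - rewrite dpsiE//.
    apply: (@near_eq_is_derive _ _ _ ((m * A)^-1 \*: (profile m k \o q))).
      by apply: filterS nc => s cs; rewrite /= cutoff_source.
    have H := @is_derive1_comp _ (profile m k) q t _ _
      (is_derive_profile m k0 (qge0 t)) dq.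
    exact: is_deriveZ.
  - rewrite /f; case: asboolP => [[_ tr]|_]; last exact: sqrtr_ge0.
    rewrite (tnorm_velocity Uo sC ac Ut tc) -/u.
    set v := derive1 u t; have := ball_metric tr v; rewrite -/(u t) => Bv.
    rewrite /dpsi -/v ler_pdivrMl ?mulr_gt0//.
    have d0 := dprofile_ge0 m k (q t).
    have cs := bform_CS Bpos (u t - a) v.
    have dl := dprofile_le k0 (ltW m0) (qge0 t).
    have sv : Num.sqrt (bform B v v) <= A * Num.sqrt (chart_metric c (u t) v v).
      have AE : Num.sqrt (A ^+ 2) = A by rewrite sqrtr_sqr gtr0_norm.
      apply: le_trans (ler_wsqrtr Bv) _.
      by rewrite (sqrtrM _ (sqr_ge0 A)) AE; exact: lexx.
    have := sqrtr_ge0 (bform B v v); have := sqrtr_ge0 (q t).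
    move: d0 cs dl sv; rewrite /q; clear; move: (dprofile _ _ _) => d.
    move: (bform B (u t - a) v) (Num.sqrt _) (Num.sqrt _) (Num.sqrt _).
    by move=> b w v1 s; exact: mul_chain_le.
have ncore : \forall s \near t, ~ core (sigma s).
  apply: (sC.1 t Ut (~` core)); apply: open_nbhs_nbhs; split.
    exact: (@closed_openC _ core closed_core).
  move=> [w wr wt]; apply: tc; rewrite -wt; apply: icoord_source.
  by apply: ball_target; move: wr; rewrite closed_ballE.
have E1 : \forall s \near t, 0 = f s.
  apply: filterS ncore => s ns; rewrite /f; case: asboolP => // -[cs sr].
  by exfalso; apply: ns; exact: mem_core.
have E2 : \forall s \near t, 0 = (cutoff \o sigma) s.
  apply: filterS ncore => s ns; rewrite /= /cutoff; case: asboolP => // -[cs sr].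
  by exfalso; apply: ns; exact: mem_core.
split.
- rewrite /prop_for /continuous_at -(nbhs_singleton E1).
  apply: cvg_trans (near_eq_cvg E1) _; exact: cvg_cst.
- rewrite -(nbhs_singleton E1).
  by apply: (near_eq_is_derive E2); exact: is_derive_cst.
- by rewrite -(nbhs_singleton E1); exact: sqrtr_ge0.
Qed.

End cutoff.

(** * Comparison of the Riemannian distance with coordinates *)

(** Extracts from the cutoff inequality, with [k] tending to 0, a bound on the coordinate radius [s]
    by the distance [d]. *)
Lemma radius_le (R : realType) (m A d s : R) :
  1 < A -> 0 < m -> 0 <= s -> d < m / (8 * A) -> A * d <= (1 - A^-1) * m ->
  (forall k, 0 < k < m -> (m - k) ^+ 2 - Num.max 0 (m - s) ^+ 2 <= 2 * m * A * d) ->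
  s <= A ^+ 2 * d.
Proof.
move=> A1 m0 s0 dm Adm H; have A0 : 0 < A by lra.
have {}H : m ^+ 2 - Num.max 0 (m - s) ^+ 2 <= 2 * m * A * d.
  rewrite leNgt; apply/negP => Hlt.
  set e := m ^+ 2 - Num.max 0 (m - s) ^+ 2 - 2 * m * A * d.
  have e0 : 0 < e by rewrite subr_gt0.
  (* With this [k] the loss [2 * m * k] is at most half of the supposed excess [e]. *)
  pose k := Num.min (m / 2) (e / (4 * m)).
  have k0 : 0 < k by rewrite lt_min !divr_gt0// mulr_gt0.
  have km : k <= m / 2 by rewrite ge_min lexx.
  have ke : k * (4 * m) <= e.
    by rewrite -ler_pdivlMr ?mulr_gt0// ge_min lexx orbT.
  have := H k; rewrite k0 /= => /(_ _); rewrite /e in ke.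
  have -> : k < m by lra.
  move=> /(_ isT); have := sqr_ge0 k; nra.
have dm' : 8 * A * d < m by rewrite mulrC -ltr_pdivlMr ?mulr_gt0.
have [ms|sm] := leP m s.
  move: H; rewrite max_l ?subr_le0// expr0n /= subr0 => H.
  exfalso; have : m * m <= m * (2 * A * d) by nra.
  rewrite ler_pM2l// => H'; nra.
move: H; rewrite max_r; last by rewrite subr_ge0 ltW.
move=> H.
have H1 : s * (2 * m - s) <= 2 * m * (A * d) by nra.
(* This crude bound, inserted for one factor of [s ^+ 2] in [H1], gives the sharper [H3]. *)
have H2 : s <= 2 * (A * d).
  have : m * s <= m * (2 * (A * d)) by nra.
  by rewrite ler_pM2l.
have H3 : s * (m - A * d) <= m * (A * d) by nra.
have H4 : m * A^-1 <= m - A * d by lra.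
have H5 : s * (m * A^-1) <= m * (A * d).
  by apply: le_trans H3; rewrite ler_wpM2l.
have : m * s <= m * (A ^+ 2 * d).
  have -> : m * s = (s * (m * A^-1)) * A by field; rewrite gt_eqF.
  have -> : m * (A ^+ 2 * d) = (m * (A * d)) * A by ring.
  by rewrite ler_pM2r.
by rewrite ler_pM2l.
Qed.

Section distance.
Variables (R : realType) (n : nat) (M : riemannianManifold R n) (x0 : M).

Let c := chart_at x0.
Let u0 := coord c x0.
Let B := gram x0.

(** The metric at [u0] is [B], and [l] converts the absolute error of [near_quadratic] into an error
    relative to [bform B v v]. *)
Lemma chart_metric_near (A : R) : 1 < A ->
  \forall u \near u0, forall v : 'rV[R]_n,
    bform B v v <= A ^+ 2 * chart_metric c u v v /\
    chart_metric c u v v <= A ^+ 2 * bform B v v.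
Proof.
move=> A1; have A0 : 0 < A by lra.
have ac : atlas c := chart_at_atlas x0.
have u0c : target c u0 by exact/coord_target/chart_at_source.
have [l l0 lB] := bform_lower_bound (posdef_gram x0).
have e0 : 0 < 1 - (A ^+ 2)^-1.
  by rewrite subr_gt0 invf_lt1 ?exprn_gt0// expr2; nra.
have Ql : \forall u \near u0, (forall w, scalar (chart_metric c u ^~ w)) /\
    (forall v, scalar (chart_metric c u v)).
  by apply: filterS (near_target u0c) => u uc; exact: chart_metric_scalar.
have Qc v w : {for u0, continuous (fun u => chart_metric c u v w)}.
  exact: chart_metric_continuous.
apply: filterS (near_quadratic Ql Qc (mulr_gt0 e0 l0)) => u H v.
have := H v; rewrite chart_metric_at ler_norml.
have := lB v; rewrite -/B; move: (bform B v v) (chart_metric c u v v) => b g lb.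
set i := (A ^+ 2)^-1; have iA : A ^+ 2 * i = 1 by rewrite mulfV// gt_eqF// exprn_gt0.
have A2 : 1 < A ^+ 2 by rewrite expr2; nra.
move: iA e0; rewrite -/i; move: A2; move: (A ^+ 2) i => a i a1 ai i1.
rewrite -mulrA => /andP[H1 H2].
have lb' := ler_wpM2l (ltW i1) lb.
have b0 : 0 <= b by apply: le_trans lb; rewrite mulr_ge0 ?sqr_ge0// ltW.
split.
  have : i * b <= g by lra.
  by move=> /(ler_wpM2l (ltW (lt_trans ltr01 a1))); rewrite mulrA ai mul1r.
apply: (@le_trans _ _ ((2 - i) * b)); first by lra.
rewrite ler_wpM2r//.
(* This is [a + i >= 2] for the inverse [i] of [a], hence [2 - i <= a]. *)
have : 0 <= i * (a - 1) ^+ 2.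
  by rewrite mulr_ge0 ?sqr_ge0// -(pmulr_rge0 _ (lt_trans ltr01 a1)) ai.
have -> : i * (a - 1) ^+ 2 = (a * i) * a - 2 * (a * i) + i by ring.
by rewrite ai; lra.
Qed.

Lemma riemannian_dist_local (A r : R) : 1 < A -> 0 < r ->
  exists2 e, 0 < e & \forall x \near x0, forall y d,
    d < e -> (riemannian_dist x y < d%:E)%E ->
    [/\ source c y, `|u0 - coord c y| < r &
      Num.sqrt (bform B (coord c y - coord c x) (coord c y - coord c x))
        <= A ^+ 2 * d].
Proof.
move=> A1 r0; have A0 : 0 < A by lra.
have ac : atlas c := chart_at_atlas x0.
have u0c : target c u0 by exact/coord_target/chart_at_source.
have Bpos : posdef B := posdef_gram x0.
have [l l0 lB] := bform_lower_bound Bpos.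
have : \forall u \near u0, target c u /\ forall v : 'rV[R]_n,
    bform B v v <= A ^+ 2 * chart_metric c u v v.
  near=> u; split; first by near: u; exact: near_target.
  move=> v; have : forall v, bform B v v <= A ^+ 2 * chart_metric c u v v /\
    chart_metric c u v v <= A ^+ 2 * bform B v v.
    by near: u; exact: chart_metric_near.
  by move=> /(_ v)[].
move=> /nbhs_normP[r2 /= r20 r2P].
pose r1 := Num.min r2 r / 2.
have r10 : 0 < r1 by rewrite divr_gt0// lt_min r20.
have r1r : r1 < r by rewrite ltr_pdivrMr// gt_min; apply/orP; right; lra.
have r1P u : `|u0 - u| <= r1 -> target c u /\ forall v : 'rV[R]_n,
    bform B v v <= A ^+ 2 * chart_metric c u v v.
  move=> ur; apply: r2P => /=; apply: le_lt_trans ur _.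
  by rewrite ltr_pdivrMr// gt_min; apply/orP; left; lra.
(* By the choice of [l], a [B]-distance to [a] below [m] means a norm distance below [r1 / 2]. *)
pose m := Num.sqrt l * (r1 / 2).
have m0 : 0 < m by apply: mulr_gt0; [rewrite sqrtr_gt0|apply: divr_gt0].
(* The first bound keeps [y] in the chart; both enter [radius_le]. *)
exists (Num.min (m / (8 * A)) ((1 - A^-1) * m / A)).
  have A1' : 0 < 1 - A^-1 by rewrite subr_gt0 invf_lt1.
  rewrite lt_min; apply/andP; split; first by rewrite divr_gt0// mulr_gt0.
  by rewrite divr_gt0// mulr_gt0.
have near_u0 : \forall x \near x0, `|u0 - coord c x| < r1 / 2.
  have /cvgrPdist_lt := @coord_continuous _ _ _ c x0 (chart_at_source x0).
  by apply; apply: divr_gt0.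
near=> x => y d; rewrite lt_min => /andP[d1 d2] xyd.
have xc : source c x by near: x; exact/near_source/chart_at_source.
set a := coord c x.
have ar : `|u0 - a| < r1 / 2.
  by rewrite /a; near: x.
have aball u : bform B (u - a) (u - a) < m ^+ 2 -> `|u0 - u| < r1.
  move=> um; have : l * `|u - a| ^+ 2 < l * (r1 / 2) ^+ 2.
    by apply: le_lt_trans (lB _) _; rewrite exprMn sqr_sqrtr ?ltW in um.
  rewrite ltr_pM2l// ltr_pXn2r ?nnegrE//; last exact/ltW/divr_gt0.
  move=> ua.
  rewrite (splitr r1) -(subrKA a) (le_lt_trans (ler_normD _ _))// ltrD//.
  by rewrite distrC.
have a_ball : bform B (a - a) (a - a) = 0 by rewrite subrr /bform !mul0mx mxE.
have key k : 0 < k < m -> cutoff c B a u0 r1 m k A y +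
    (m * A)^-1 * ((m - k) ^+ 2 / 2) <= d.
  move=> /andP[k0 km].
  have := @cutoff_le_dist _ _ M c B a u0 r1 m k A ac Bpos r10 m0 k0 A0
    (fun u ur => (r1P u ur).1) (fun u ur => (r1P u ur).2) aball x y.
  move=> /le_lt_trans /(_ xyd); rewrite lte_fin => /ltW.
  rewrite (@cutoff_source _ _ M c B a u0 r1 m k A aball x xc) -/a a_ball.
  rewrite /profile add0r sqrtr_sqr gtr0_norm// max_r; last by rewrite subr_ge0 ltW.
  by rewrite mulNr mulrN opprK.
(* Otherwise the cutoff vanishes at [y], and [k = m / 2] gives [m / (8 * A) <= d]. *)
have [cy yr] : source c y /\ `|u0 - coord c y| <= r1.
  apply: contrapT => ny.
  have := key (m / 2); rewrite /cutoff; case: asboolP => // _.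
  have -> : 0 < m / 2 < m by rewrite divr_gt0//=; lra.
  move=> /(_ isT); rewrite add0r => H.
  have E : (m * A)^-1 * ((m - m / 2) ^+ 2 / 2) = m / (8 * A).
    by field; rewrite !gt_eqF.
  by move: H; rewrite E leNgt d1.
split => //; first exact: le_lt_trans r1r.
apply: (@radius_le _ m) => //.
  by rewrite mulrC -ler_pdivlMr// ltW.
move=> k km; have := key k km.
rewrite (@cutoff_source _ _ M c B a u0 r1 m k A aball y cy).
set q := bform B _ _; rewrite -mulrDr (ler_pdivrMl _ _ (mulr_gt0 m0 A0)).
rewrite /profile => H.
have : Num.max 0 (m - Num.sqrt (q + k ^+ 2)) ^+ 2 <= Num.max 0 (m - Num.sqrt q) ^+ 2.
  have M0 z : 0 <= Num.max 0 z :> R by rewrite le_max lexx.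
  rewrite ler_pXn2r ?nnegrE ?M0// ge_max M0 /= le_max lerB ?orbT//.
  by rewrite ler_wsqrtr// lerDl sqr_ge0.
by move: H; move: (_ ^+ 2) (_ ^+ 2) (_ ^+ 2) => *; lra.
Unshelve. all: by end_near. Qed.

End distance.

(** * Second-order estimate *)

(** The mean value theorem applied to the trapezoid error [q], and then to [p1], turns the error
    into [t / 2 * (p2 s - p2 t)]. *)
Lemma trapezoid_le (R : realType) (p p1 p2 : R -> R) (K : R) :
  (forall t : R, 0 <= t <= 1 -> is_derive t 1 p (p1 t)) ->
  (forall t : R, 0 <= t <= 1 -> is_derive t 1 p1 (p2 t)) ->
  (forall s t, 0 <= s <= 1 -> 0 <= t <= 1 -> p2 s - p2 t <= K) ->
  p 1 - p 0 <= (p1 1 + p1 0) / 2 + K / 2.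
Proof.
move=> dp dp1 osc.
have K0 : 0 <= K by have := osc 0 0; rewrite subrr lexx ler01; apply.
have within_cont (h dh : R -> R) b : 0 <= b <= 1 ->
    (forall t : R, 0 <= t <= 1 -> is_derive t 1 h (dh t)) ->
    {within `[0, b], continuous h}.
  move=> /andP[b0 b1] hP; apply: continuous_in_subspaceT => t /[!inE]/=.
  rewrite in_itv /= => /andP[t0 tb].
  apply: differentiable_continuous; apply/derivable1_diffP.
  by have [] := hP t; rewrite ?t0 ?(le_trans tb).
pose q t := p t - t / 2 * (p1 t + p1 0).
pose dq t := p1 t - ((p1 t + p1 0) / 2 + t / 2 * p2 t).
have dqP (t : R) : 0 <= t <= 1 -> is_derive t 1 q (dq t).
  move=> t01; have H := dp t t01; have H1 := dp1 t t01.
  rewrite (_ : q = p \- ((fun t => t / 2) * (fun t => p1 t + p1 0)))//.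
  apply: is_derive_eq; rewrite /dq /GRing.scale /=; ring.
have [t t01 qt] : exists2 t, t \in `]0, 1[ & q 1 - q 0 = dq t * (1 - 0).
  apply: MVT => //; last by apply: within_cont dqP; rewrite ler01 lexx.
  by move=> t; rewrite in_itv/= => /andP[/ltW t0 /ltW t1]; apply: dqP; rewrite t0.
move: t01; rewrite in_itv /= => /andP[t0 t1].
have [s st ps] : exists2 s, s \in `]0, t[ & p1 t - p1 0 = p2 s * (t - 0).
  apply: MVT => //; last by apply: within_cont dp1; rewrite (ltW t0) (ltW t1).
  move=> s; rewrite in_itv/= => /andP[s0 st]; apply: dp1.
  by rewrite (ltW s0) ltW// (lt_trans st).
move: st; rewrite in_itv /= => /andP[s0 st].
have o : p2 s - p2 t <= K.
  by apply: osc; [rewrite (ltW s0) (ltW (lt_trans st t1))|rewrite !ltW].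
have : t * (p2 s - p2 t) <= 1 * K.
  have [d0|d0] := leP 0 (p2 s - p2 t); first by apply: ler_pM => //; exact: ltW.
  by rewrite mul1r (le_trans _ K0)// nmulr_lle0// ltW.
move: qt ps; rewrite /q /dq !subr0 mulr1 => qt ps.
have ps' : p1 t = p1 0 + p2 s * t by rewrite -ps addrC subrK.
by move: qt; rewrite ps' mul0r; lra.
Qed.

Lemma dist_le_diff (R : realType) (a b c e d : R) :
  `|a - c| <= e * d -> `|b - c| <= e * d -> a - b <= 2 * e * d.
Proof. by rewrite !ler_norml => /andP[_ H1] /andP[H2 _]; lra. Qed.

Section line.
Variables (R : realType) (n : nat).
Implicit Types (F : 'rV[R]_n -> R^o) (u v w : 'rV[R]_n).

Lemma is_derive_line F w v (t : R) : differentiable F (w + t *: v) ->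
  is_derive t 1 (fun s => F (w + s *: v)) ('D_v F (w + t *: v)).
Proof.
move=> dF; have := @diff_derivable _ _ _ _ _ v dF.
have E : (fun h : R => h^-1 *: (F (w + (h *: (1 : R) + t) *: v) - F (w + t *: v))) =
    (fun h : R => h^-1 *: (F (h *: v + (w + t *: v)) - F (w + t *: v))).
  apply/funext => h.
  rewrite (_ : w + (h *: (1 : R) + t) *: v = h *: v + (w + t *: v)) //.
  by rewrite [h *: (1 : R)]mulr1 scalerDl addrCA.
by rewrite /derivable /derive -E => H; apply: DeriveDef.
Qed.

(** Fermat's rule on the line through [w] in the direction [v]. *)
Lemma derive_local_min F w v : (\forall u \near w, differentiable F u) ->
  (\forall u \near w, F w <= F u) -> 'D_v F w = 0.
Proof.
move=> dF Fmin.
pose g (s : R) := F (w + s *: v).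
have w0 : w + (0 : R) *: v = w by rewrite scale0r addr0.
have c0 : (fun s : R => w + s *: v) @ (0 : R) --> w.
  rewrite -{2}w0; apply: cvgD; first exact: cvg_cst.
  by apply: cvgZr_tmp; exact: cvg_id.
have /nbhs_normP[e /= e0 eP] : \forall s \near (0 : R),
    differentiable F (w + s *: v) /\ F w <= F (w + s *: v).
  by apply: (c0 (fun u => differentiable F u /\ F w <= F u)); exact: filterI.
have in_e s : s \in `](- e), e[ ->
    differentiable F (w + s *: v) /\ F w <= F (w + s *: v).
  by rewrite in_itv /= => ?; apply: eP => /=; rewrite sub0r normrN ltr_norml.
have e0' : 0 \in `](- e), e[ by rewrite in_itv/= e0 oppr_lt0 e0.
have H : is_derive (0 : R) 1 g 0.
  apply: (@derive1_at_min _ g (- e) e) => //.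
  - by rewrite ge0_cp// ltW.
  - by move=> t /in_e[/is_derive_line[]].
  - by move=> t /in_e[_]; rewrite /g w0.
have := is_derive_line (in_e 0 e0').1; rewrite w0 => -[_ <-].
by case: H.
Qed.

(** On a small ball, which is convex, the Hessian is within [e] of its value at [u0]; its
    oscillation along a segment is thus at most [2 * e * |v| ^ 2], and the trapezoid rule halves
    it. *)
Lemma near_trapezoid F (U : set 'rV[R]_n) u0 (e : R) :
  open U -> U u0 -> Ck_on 2 U F -> 0 < e ->
  exists2 r, 0 < r & forall u w, `|u0 - u| < r -> `|u0 - w| < r ->
    [/\ U u, U w & F u - F w <=
      ('D_(u - w) F u + 'D_(u - w) F w) / 2 + e * `|u - w| ^+ 2].
Proof.
move=> Uo Uu0 [dF dDF] e0.
pose Q u v w := 'D_w (fun x => 'D_v F x : R^o) u : R.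
have nU u : U u -> \forall x \near u, U x.
  by move=> Uu; apply: open_nbhs_nbhs.
have Ql : \forall u \near u0,
    (forall w, scalar (Q u ^~ w)) /\ (forall v, scalar (Q u v)).
  apply: filterS (nU _ Uu0) => u Uu; split; last first.
    by move=> v; apply: derive_scalar; exact: (dDF v).1.
  move=> w a v v'; rewrite /Q.
  have dv z : derivable (fun x => 'D_z F x : R^o) u w.
    by apply: diff_derivable; exact: (dDF z).1.
  rewrite (@near_eq_derive _ _ _ _ ((a \*: (fun x => 'D_v F x : R^o)) \+
     (fun x => 'D_v' F x : R^o))); last first.
    by apply: filterS (nU _ Uu) => x Ux; exact: derive_scalar (dF x Ux) _ _ _.
  by rewrite deriveD ?deriveZ//; exact: derivableZ.
have Qc v w : {for u0, continuous (fun u => Q u v w)}.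
  exact: ((dDF v).2 w u0 Uu0).
have : \forall u \near u0, U u /\
    forall v, `|Q u v v - Q u0 v v| <= e * `|v| ^+ 2.
  exact: filterI (nU _ Uu0) (near_quadratic Ql Qc e0).
move=> /nbhs_normP[r /= r0 rP]; exists r => // u w ur wr.
have [[Uu _] [Uw _]] := (rP _ ur, rP _ wr); split => //.
set v := u - w.
have seg (t : R) : 0 <= t <= 1 -> U (w + t *: v) /\
    forall z, `|Q (w + t *: v) z z - Q u0 z z| <= e * `|z| ^+ 2.
  move=> /andP[t0 t1].
  suff H : `|u0 - (w + t *: v)| < r by exact: (rP _ H).
  have -> : u0 - (w + t *: v) = (1 - t) *: (u0 - w) + t *: (u0 - u).
    by rewrite /v; apply/rowP => i; rewrite !mxE; ring.
  apply: le_lt_trans (ler_normD _ _) _; rewrite !normrZ.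
  rewrite (ger0_norm t0) ger0_norm ?subr_ge0//.
  have [->|tN0] := eqVneq t 0; first by rewrite subr0 mul1r mul0r addr0.
  have tp : 0 < t by rewrite lt_neqAle eq_sym tN0.
  have -> : r = (1 - t) * r + t * r by ring.
  rewrite ler_ltD//; last by rewrite ltr_pM2l.
  by rewrite ler_wpM2l ?subr_ge0// ltW.
have w1 : w + (1 : R) *: v = u by rewrite scale1r addrC subrK.
have w0 : w + (0 : R) *: v = w by rewrite scale0r addr0.
have := @trapezoid_le _ (fun t => F (w + t *: v)) (fun t => 'D_v F (w + t *: v))
  (fun t => Q (w + t *: v) v v) (2 * e * `|v| ^+ 2).
rewrite w1 w0 => H.
have -> : e * `|v| ^+ 2 = 2 * e * `|v| ^+ 2 / 2 by field.
apply: H.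
- by move=> t /seg[Ut _]; apply: is_derive_line; exact: dF.
- move=> t /seg[Ut _]; apply: (@is_derive_line (fun x => 'D_v F x)).
  exact: (dDF v).1.
- move=> s t /seg[_ /(_ v)] Hs /seg[_ /(_ v)] Ht.
  exact: dist_le_diff Hs Ht.
Qed.

End line.

(** * Choice of constants and conclusion *)

Lemma exists_pow4_le (R : realType) (q : R) : 1 < q ->
  exists A, [/\ 1 < A, A <= 2 & A ^+ 4 <= (1 + q) / 2].
Proof.
(* For [x] between 0 and 1, [(1 + x) ^ 4] is at most [1 + 15 * x]. *)
move=> q1; pose x := Num.min 1 ((q - 1) / 30).
have x0 : 0 < x by rewrite lt_min ltr01 divr_gt0// subr_gt0.
have x1 : x <= 1 by rewrite ge_min lexx.
have xq : x <= (q - 1) / 30 by rewrite ge_min lexx orbT.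
exists (1 + x); split; [by lra|by lra|].
have x2 : x * x <= x by nra.
have x3 : x * (x * x) <= x by nra.
have x4 : x * (x * (x * x)) <= x by nra.
have -> : (1 + x) ^+ 4 = 1 + 4 * x + 6 * (x * x) + 4 * (x * (x * x)) +
   x * (x * (x * x)) by ring.
by lra.
Qed.

(** Settles the points of zero gradient, where [d] may be taken arbitrarily small. *)
Lemma quadratic_bound_tends (R : realType) (s C e : R) : 0 < e -> 0 <= C ->
  (forall d, 0 < d < e -> s <= C * d ^+ 2) -> s <= 0.
Proof.
move=> e0 C0 H; rewrite leNgt; apply/negP => s0.
pose d := Num.min (e / 2) (Num.min 1 (s / (2 * (C + 1)))).
have C1 : 0 < 2 * (C + 1) by lra.
have d0 : 0 < d by rewrite !lt_min ltr01 !divr_gt0.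
have de : d <= e / 2 by rewrite ge_min lexx.
have d1 : d <= 1 by rewrite !ge_min lexx orbT.
have ds : d * (2 * (C + 1)) <= s.
  by rewrite -ler_pdivlMr// !ge_min lexx !orbT.
have := H d; rewrite d0 /= => /(_ _); have -> : d < e by lra.
move=> /(_ isT); rewrite expr2 => H'.
have : d * d <= d by nra.
move=> /(ler_wpM2l C0); nra.
Qed.

Lemma level_bound (R : realType) (s g mu nu A q h e : R) :
  0 < nu -> q * nu = mu -> 1 < q -> 1 < A -> A <= 2 ->
  A ^+ 4 <= (1 + q) / 2 -> h = mu * (q - 1) / 256 -> 0 < e -> 0 <= g ->
  A * g < e * mu ->
  (forall d, 0 < d < e -> g < mu * d ->
    s <= g * (A * (A ^+ 2 * d)) / 2 + h * (A ^+ 2 * d) ^+ 2) ->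
  s <= 1 / (2 * nu) * g ^+ 2.
Proof.
move=> nu0 qE q1 A1 A2 A4 hE e0 g0 ge H.
have mu0 : 0 < mu by rewrite -qE; nra.
have A0 : 0 < A by lra.
have h0 : 0 < h by rewrite hE divr_gt0// mulr_gt0// subr_gt0.
have [g00|gN0] := eqVneq g 0.
  rewrite g00 expr0n mulr0.
  apply: (@quadratic_bound_tends _ s (h * A ^+ 4) e) => //.
    by rewrite mulr_ge0 ?exprn_ge0// ltW.
  move=> d /[dup] de /andP[d0 _]; have := H d de.
  rewrite g00 mulr_gt0// => /(_ isT).
  by rewrite !mul0r add0r exprMn -exprM mulrA.
have {gN0}gp : 0 < g by rewrite lt_neqAle eq_sym gN0.
pose d := A * g / mu.
have dE : d * mu = A * g by rewrite /d divfK// gt_eqF.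
have d0 : 0 < d by rewrite divr_gt0// mulr_gt0.
have de : d < e by rewrite ltr_pdivrMr.
(* The factor [A > 1] in [d] makes this strict once [g] is positive. *)
have gd : g < mu * d by rewrite mulrC dE; nra.
have := H d; rewrite d0 de => /(_ isT gd); move=> Hs; apply: (le_trans Hs).
have -> : g * (A * (A ^+ 2 * d)) / 2 + h * (A ^+ 2 * d) ^+ 2 =
  (A ^+ 4 + 2 * (q - 1) / 256 * A ^+ 6) / (2 * mu) * g ^+ 2.
  by rewrite /d hE; field; rewrite gt_eqF.
rewrite ler_wpM2r ?sqr_ge0// -qE.
have -> : 1 / (2 * nu) = q / (2 * (q * nu)).
  by field; rewrite !gt_eqF//; lra.
apply: ler_wpM2r; first by rewrite invr_ge0 mulr_ge0// qE ltW.
(* With 256 in [h], the second term is at most [(q - 1) / 2]; added to [(1 + q) / 2] it gives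
   exactly [q]. *)
have A6 : A ^+ 6 <= 64.
  have -> : (64 : R) = 2 ^+ 6 by ring.
  by rewrite ler_pXn2r ?nnegrE// ltW.
have : (q - 1) * A ^+ 6 <= (q - 1) * 64 by rewrite ler_wpM2l// subr_ge0 ltW.
by lra.
Qed.

(** The infimum need not be attained; the strict inequality leaves room for an actual point of
    [S]. *)
Lemma dist_set_lt (R : realType) (n : nat) (M : riemannianManifold R n)
    (x : M) (S : set M) (mu g d : R) : 0 < mu ->
  (mu%:E * dist_set x S <= g%:E)%E -> g < mu * d ->
  exists2 y, S y & (riemannian_dist x y < d%:E)%E.
Proof.
move=> mu0 mg gd.
have : (dist_set x S < d%:E)%E.
  rewrite ltNge; apply/negP => dS; move: mg; rewrite leNgt => /negP; apply.
  apply: (@lt_le_trans _ _ (mu%:E * d%:E)%E); first by rewrite -EFinM lte_fin.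
  by rewrite lee_wpmul2l// lee_fin ltW.
by move=> /ereal_inf_lt[_ [y Sy <-] yd]; exists y.
Qed.

Unset Implicit Arguments.

Theorem proposition2p4 (R : realType) (n : nat) (M : riemannianManifold R n)
    (f : M -> R) (xbar : M) (mu : R) :
  Ck_fun 2 f ->
  local_minimum f xbar ->
  0 < mu ->
  error_bound f xbar mu ->
  forall mu' : R, 0 < mu' -> mu' < mu -> polyak_lojasiewicz f xbar mu'.
Proof.
move=> fC2 _ mu0 EB nu nu0 numu.
have fC1 : Ck_fun 1 f.
  move=> c ac; have [H1 H2] := fC2 c ac; split => // v u uc.
  by apply: differentiable_continuous; exact: (H2 v).1.
set c := chart_at xbar; set F : 'rV[R]_n -> R^o := f \o icoord c.
set u0 := coord c xbar; set B := gram xbar.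
have ac : atlas c := chart_at_atlas xbar.
have xc : source c xbar := chart_at_source xbar.
have u0c : target c u0 by exact: coord_target.
have [l l0 lB] := bform_lower_bound (posdef_gram xbar).
(* The ratio [q > 1] is the whole slack, to be split between [A] and [h]. *)
pose q := mu / nu.
have qE : q * nu = mu by rewrite divfK// gt_eqF.
have q1 : 1 < q by rewrite ltr_pdivlMr// mul1r.
have [A [A1 A2 A4]] := exists_pow4_le q1.
have A0 : 0 < A by lra.
pose h := mu * (q - 1) / 256.
have h0 : 0 < h by rewrite divr_gt0// mulr_gt0// subr_gt0.
(* The tolerance [h * l] makes the remainder at most [h] times the form [B]. *)
have [r r0 rP] := near_trapezoid (@open_target _ _ _ c) u0c (fC2 c ac)
  (mulr_gt0 h0 l0).
have [e e0 eP] := @riemannian_dist_local _ _ M xbar A r A1 r0.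
have ccont := @coord_continuous _ _ _ c xbar xc.
(* Below this threshold the distance [A * g / mu] used in [level_bound] is less than [e]. *)
pose g1 := e * mu / A.
have g10 : 0 < g1 by rewrite divr_gt0// mulr_gt0.
have fcont : f y @[y --> xbar] --> f xbar.
  apply: (@cvg_trans _ ((F \o coord c) y @[y --> xbar])).
    apply: near_eq_cvg; apply: filterS (near_source xc) => y yc.
    by rewrite /F /= coordK.
  rewrite -{2}(coordK xc); apply: (@continuous_comp _ _ _ (coord c) F) => //.
  by apply: differentiable_continuous; exact: (fC2 c ac).1.
have near_f : \forall x \near xbar, f x - f xbar <= 1 / (2 * nu) * g1 ^+ 2.
  have p0 : 0 < 1 / (2 * nu) * g1 ^+ 2.
    by rewrite mulr_gt0 ?exprn_gt0// divr_gt0// mulr_gt0.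
  move/cvgrPdist_le : fcont => /(_ _ p0); apply: filterS => x.
  by rewrite distrC; apply: le_trans; exact: ler_norm.
have near_r : \forall x \near xbar, `|u0 - coord c x| < r.
  by move/cvgrPdist_lt : ccont; apply.
have near_metric : \forall x \near xbar, forall v : 'rV[R]_n,
    bform B v v <= A ^+ 2 * chart_metric c (coord c x) v v /\
    chart_metric c (coord c x) v v <= A ^+ 2 * bform B v v.
  exact: ccont (chart_metric_near xbar A1).
rewrite /polyak_lojasiewicz; near=> x.
have xs : source c x by near: x; exact: near_source.
have xr : `|u0 - coord c x| < r by near: x.
have xmet : forall v : 'rV[R]_n,
    bform B v v <= A ^+ 2 * chart_metric c (coord c x) v v /\
    chart_metric c (coord c x) v v <= A ^+ 2 * bform B v v by near: x.
have xEB : (mu%:E * dist_set x (local_minima_at_level f (f xbar))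
       <= (tnorm (gradient f x))%:E)%E by near: x.
have xf : f x - f xbar <= 1 / (2 * nu) * g1 ^+ 2 by near: x.
have xdist : forall y d, d < e -> (riemannian_dist x y < d%:E)%E ->
    [/\ source c y, `|u0 - coord c y| < r &
      Num.sqrt (bform B (coord c y - coord c x) (coord c y - coord c x))
        <= A ^+ 2 * d] by near: x.
have grad_le v := derive_le_gradient v fC1 ac xs.
set g := tnorm (gradient f x) in xEB grad_le *.
have g0 : 0 <= g by exact: sqrtr_ge0.
(* For a gradient of norm at least [g1], continuity of [f] suffices. *)
have [gg1|gg1] := leP g1 g.
  apply: le_trans xf _; apply: ler_wpM2l.
    by rewrite divr_ge0// mulr_ge0// ltW.
  by rewrite ler_pXn2r// nnegrE ltW.
apply: (@level_bound _ _ g mu nu A q h e) => //.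
  by rewrite mulrC -ltr_pdivlMr.
move=> d /andP[d0 de] gd.
have [y [ymin fy] xyd] := dist_set_lt mu0 xEB gd.
have [ys yr ydist] := xdist y d de xyd.
set u := coord c x in xr grad_le xmet ydist *.
set w := coord c y in yr ydist *.
have [ut wt H] : [/\ target c u, target c w & F u - F w <=
    ('D_(u - w) F u + 'D_(u - w) F w) / 2 + h * l * `|u - w| ^+ 2] := rP u w xr yr.
have Fw : F w = f xbar by rewrite /F /= coordK.
have Fu : F u = f x by rewrite /F /= coordK.
(* The point [y] of the level set is itself a local minimum of [f], hence [w] is one of [F]. *)
have Dw : 'D_(u - w) F w = 0.
  apply: derive_local_min.
    apply: filterS (near_target wt) => z zt; exact: (fC2 c ac).1.
  have fmin : \forall z \near icoord c w, f y <= f z by rewrite coordK.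
  have {}fmin : \forall z \near w, f y <= f (icoord c z).
    exact: (icoord_continuous wt) fmin.
  by apply: filterS fmin => z; rewrite /F /= coordK.
move: H; rewrite Fw Fu Dw addr0 => H; apply: le_trans H _.
have Buw : bform B (u - w) (u - w) = bform B (w - u) (w - u).
  by rewrite -opprB -scaleN1r bformZZ sqrrN expr1n mul1r.
have sB : Num.sqrt (bform B (u - w) (u - w)) <= A ^+ 2 * d by rewrite Buw.
(* The first-order term uses Cauchy-Schwarz and the comparison of the metric with [B]; the remainder
   uses the lower bound [l]. *)
apply: lerD.
  rewrite ler_wpM2r ?invr_ge0//; apply: le_trans (grad_le _) _.
  rewrite ler_wpM2l//; apply: le_trans (ler_wsqrtr (xmet _).2) _.
  rewrite (sqrtrM _ (sqr_ge0 A)) sqrtr_sqr gtr0_norm//.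
  by rewrite ler_wpM2l// ltW.
rewrite -mulrA ler_wpM2l ?(ltW h0)//; apply: le_trans (lB _) _.
rewrite -[leLHS](sqr_sqrtr (bform_ge0 (posdef_gram xbar) _)).
by rewrite ler_pXn2r ?nnegrE ?sqrtr_ge0// mulr_ge0 ?sqr_ge0 ?(ltW d0).
Unshelve. all: by end_near. Qed.
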